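(* Assume that $\mathrm{MA(countable)}$ holds. Then there exists a non-principal ultrafilter $\mathcal{U}\subseteq 2^\omega$ on $\omega$ that is countable dense homogeneous.
   Context: Every subset of $\omega$ is identified with its characteristic function, so an ultrafilter on $\omega$ is regarded as a subset of the Cantor set $2^\omega$ and carries the subspace topology. A (separable metrizable) space $X$ is countable dense homogeneous if for every pair $(D,E)$ of countable dense subsets of $X$ there exists a homeomorphism $f:X\to X$ such that $f[D]=E$. $\mathrm{MA(countable)}$ (Martin's Axiom for countable posets) is the statement: for every non-empty countable partially ordered set $\mathbb{P}$ and every collection $\mathcal{D}$ of dense subsets of $\mathbb{P}$ with $|\mathcal{D}|<\mathfrak{c}=2^{\aleph_0}$, there is a filter $G\subseteq\mathbb{P}$ that meets every element of $\mathcal{D}$. *)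

(* Defs.v *)
From HB Require Import structures.
From mathcomp Require Import all_boot all_order.
From mathcomp Require Import boolp classical_sets functions cardinality filter.
From mathcomp Require Import topology cantor.

Set Implicit Arguments.
Unset Strict Implicit.
Unset Printing Implicit Defensive.

Local Open Scope classical_set_scope.
Local Open Scope card_scope.
Local Open Scope order_scope.

(* Forcing convention: smaller elements are the stronger conditions. *)
Definition poset_dense d (P : porderType d) (D : set P) : Prop :=
  forall p, exists2 q, D q & q <= p.

Definition poset_filter d (P : porderType d) (G : set P) : Prop :=
  [/\ G !=set0,
      forall p q, G p -> p <= q -> G q &
      forall p q, G p -> G q -> exists r, [/\ G r, r <= p & r <= q]].

Definition card_lt T U (A : set T) (B : set U) : Prop := A #<= B /\ A #!= B.

Definition MA_countable : Prop :=
  forall (d : Order.disp_t) (P : porderType d) (DD : set (set P)),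
    [set: P] !=set0 -> countable [set: P] ->
    (forall D, DD D -> poset_dense D) ->
    card_lt DD [set: cantor_space] ->
    exists2 G : set P, poset_filter G & forall D, DD D -> G `&` D !=set0.

Definition homeomorphism (X Y : topologicalType) (f : X -> Y) : Prop :=
  continuous f /\
  exists g : Y -> X, [/\ cancel f g, cancel g f & continuous g].

Definition countable_dense_homogeneous (X : topologicalType) : Prop :=
  forall D E : set X,
    countable D -> dense D -> countable E -> dense E ->
    exists2 f : X -> X, homeomorphism f & f @` D = E.

Definition char_fun (A : set nat) : cantor_space := fun n => n \in A.

Definition nonprincipal (F : set_system nat) : Prop :=
  forall n, F <> principal_filter n.

(* The coercion of the set [char_fun @` F] to a type is [set_type], which
   carries the topology induced by the inclusion into the Cantor space (unlike
   [subspace], whose carrier is the whole ambient space). *)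
Definition filter_space (F : set_system nat) : topologicalType :=
  (char_fun @` F : set cantor_space).

(* Main.v *)
From HB Require Import structures.
Require Import Defs.
From mathcomp Require Import all_boot all_order finmap.
From mathcomp Require Import boolp classical_sets functions cardinality filter.
From mathcomp Require Import topology cantor.
From mathcomp Require wochoice.

(** Call two points of the Cantor set n-close when their first n digits agree,
and call a map an isometry when it preserves n-closeness for all n.  Suppose
that f is an isometry of the Cantor set onto itself and that w is a set in an
ultrafilter U such that every x has the same digits as f x on w.  Then x
belongs to U if and only if f x does, since the two differ only off w; so f
restricts to a homeomorphism of U.  It therefore suffices to build U so that,
for all countable dense subsets D and E of U, some w in U admits such an
isometry with f[D] = E.  An isometric bijection from D to E that fixes the
digits in w is enough: D is dense, and digit n of f x has to be
that of the image of any member of D that is (n+1)-close to x ([completion]).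
(U contains the cofinite sets, so it is non-principal, and its dense subsets are
dense in the Cantor set.)

The pairs (D, E) are handled one at a time, along a well-order of the continuum
whose proper initial segments have fewer than continuum many elements
([small_segments]).  When a pair is reached, fewer than continuum many sets have
been put into U; let F be the filter which they generate.  If some member of D
or E is not in F, its complement can be put into U, and then (D, E) is no longer
a pair of subsets of U.  Otherwise Martin's Axiom is applied to the finite
approximations of w and of the bijection: a condition is a finite set a with a
finite partial isometry from D to E preserving the digits in a
([ex_generic_isometry]).  The genericity requirements are as follows.

- Every element of D is in the domain and every element of E is in the range.
  A finite partial isometry that fixes the digits in a extends to any new point
  x of the Cantor set: if c is the point of the domain closest to x, add to x,
  digit by digit modulo 2, the difference between c and its image.  As E is
  dense, the value can be moved into E without changing the finitely many digits
  that matter ([isometry_extend]).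

- w meets every finite intersection of the sets chosen before, so that w can be
  put into U.  A digit k may be added to a as soon as every point d of the
  current domain has the same digit k as its image; this holds for all k in a
  set in F, because all points of D and E are in F and it suffices that k
  belongs to the finitely many points involved ([meet_conds_dense]).

The number of requirements of the second kind is the number of finite subsets of
a family with fewer than continuum many members.  It is less than the continuum
because an infinite set has as many elements as finite sequences of elements
([card_seq_le]). *)

Set Implicit Arguments.
Unset Strict Implicit.
Unset Printing Implicit Defensive.

Local Open Scope classical_set_scope.
Local Open Scope card_scope.
Local Open Scope nat_scope.

(** * The Cantor set as a metric space *)

Local Notation binseq := (nat -> bool).

Definition agree n (x y : binseq) := forall k, k < n -> x k = y k.

Lemma agree_sym n x y : agree n x y -> agree n y x.
Proof. by move=> xy k /xy. Qed.
Lemma agree_trans n y x z : agree n x y -> agree n y z -> agree n x z.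
Proof. by move=> xy yz k kn; rewrite xy // yz. Qed.
Lemma agree_le n m x y : m <= n -> agree n x y -> agree m x y.
Proof. by move=> mn xy k km; apply/xy/(leq_trans km). Qed.

Lemma agree_eq x y : (forall n, agree n x y) -> x = y.
Proof. by move=> xy; apply/funext => n; exact: (xy n.+1). Qed.

Lemma nbhs_agree n (x : cantor_space) : nbhs x (agree n x).
Proof.
elim: n => [|n IHn]; first exact: filterE.
have xn : nbhs x [set y : cantor_space | x n = y n].
  apply: (@proj_continuous nat (fun=> bool) n x [set b | x n = b]).
  by rewrite nbhs_principalE.
apply: filterS (filterI IHn xn) => y [xy xyn] k.
by rewrite ltnS leq_eqVlt => /predU1P[->|/xy].
Qed.

Lemma open_agree n x : open (agree n x : set cantor_space).
Proof.
rewrite openE => y xy; apply: filterS (nbhs_agree n y) => z.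
exact: agree_trans.
Qed.

(** Digit n of the image is determined by the first n + 1 digits of the
argument. *)
Lemma nonexpansive_continuous (f : cantor_space -> cantor_space) :
  (forall n x y, agree n x y -> agree n (f x) (f y)) -> continuous f.
Proof.
move=> fP x; apply/cvg_sup => n A [_ [[/= W _ <-] Wfx] sWA].
apply: filterS (nbhs_agree n.+1 x) => y /fP fxy; apply: sWA => /=.
by rewrite -(fxy n).
Qed.

(** * Cardinality: finite sequences and sets smaller than the continuum *)

(** A maximal partial bijection between the two sets exhausts one of them. *)
Lemma card_le_total T U (A : set T) (B : set U) : A #<= B \/ B #<= A.
Proof.
pose P (G : set (T * U)) := G `<=` A `*` B /\
  forall p q, G p -> G q -> (p.1 = q.1 <-> p.2 = q.2).
have chainP (F : set (set (T * U))) : F `<=` P -> total_on F subset ->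
    P (\bigcup_(X in F) X).
  move=> FP Ftot; split; first by move=> p [X /FP[+ _]]; exact.
  move=> p q [X FX Xp] [Y FY Yq].
  by have [/(_ _ Xp)|/(_ _ Yq)] := Ftot _ _ FX FY;
    [have [_] := FP _ FY|have [_] := FP _ FX]; move=> + ?; exact.
have [G [[GAB Ginj] Gmax]] := Zorn_bigcup chainP.
have injG : {in G &, injective (@fst T U)}.
  move=> [x y] [x' y'] /set_mem Gp /set_mem Gq /= xx'.
  by have /= <- // := (Ginj _ _ Gp Gq).1 xx'; rewrite xx'.
have injG' : {in G &, injective (@snd T U)}.
  move=> [x y] [x' y'] /set_mem Gp /set_mem Gq /= yy'.
  by have /= <- // := (Ginj _ _ Gp Gq).2 yy'; rewrite yy'.
have {Gmax} [AG|BG] : A `<=` fst @` G \/ B `<=` snd @` G.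
  apply: contrapT => /not_orP[/existsNP[a /not_implyP[Aa Ga]]].
  move=> /existsNP[b /not_implyP[Bb Gb]].
  have Gn x y : G (x, y) -> x <> a /\ y <> b.
    by move=> Gxy; split=> e; [apply: Ga|apply: Gb]; exists (x, y).
  apply: (Gmax (G `|` [set (a, b)])).
    split=> [|/(_ (a, b)) H]; first exact: subsetUl.
    by have [] // := Gn a b; apply: H; right.
  split=> [p [/GAB//|->//]|p q].
  case: p q => [x y] [x' y'] [Gp|[-> ->]] [Gq|[-> ->]] //=.
  - exact: Ginj Gp Gq.
  - by have [] := Gn _ _ Gp.
  - by have [? ?] := Gn _ _ Gq; split=> /esym.
- left; apply: card_le_trans (subset_card_le AG) _.
  rewrite (card_le_eql (inj_card_eq injG)) -(card_le_eql (inj_card_eq injG')).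
  by apply: subset_card_le => _ [p /GAB[]] _ + <-.
- right; apply: card_le_trans (subset_card_le BG) _.
  rewrite (card_le_eql (inj_card_eq injG')) -(card_le_eql (inj_card_eq injG)).
  by apply: subset_card_le => _ [p /GAB[]] + _ <-.
Qed.

Definition seqs T (A : set T) : set (seq T) := [set s | all (mem A) s].

Definition seq_code (T : Type) (A : set T) (f : seq T -> T) :=
  set_fun (seqs A) A f /\ set_inj (seqs A) f.

Lemma sub_seqs T (A B : set T) : A `<=` B -> seqs A `<=` seqs B.
Proof. by move=> AB s; apply: sub_all => x /set_mem/AB/mem_set. Qed.

Lemma map_seqs T U (A : set T) (B : set U) (f : T -> U) s :
  set_fun A B f -> seqs A s -> seqs B (map f s).
Proof.
move=> fAB; rewrite /seqs /= all_map; apply: sub_all => x /set_mem/fAB.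
exact: mem_set.
Qed.

(** A code for the finite sequences over A leaves room for a second copy of A:
the elements of A are coded by sequences of length 1, and those of B, matched
with elements of A, by sequences of length 2. *)
Lemma double_code (T : pointedType) (A B : set T) (f : seq T -> T) :
    seq_code A f -> B #<= A ->
  exists c, set_fun (A `|` B) A c /\ set_inj (A `|` B) c.
Proof.
move=> [fA f_inj] /pcard_leP[h].
have hA x : (A `|` B) x -> x \notin A -> h x \in A.
  by move=> [Ax|Bx]; [rewrite mem_set|move=> _; apply/mem_set/funS].
pose d x := if x \in A then [:: x] else [:: h x; h x].
have dA x : (A `|` B) x -> seqs A (d x).
  by move=> ABx; rewrite /d; case: ifPn => Ax; rewrite /seqs /= ?Ax ?hA.
exists (f \o d); split; first by move=> x /dA/fA.
move=> x y /set_mem ABx /set_mem ABy /f_inj.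
move=> /(_ (mem_set (dA _ ABx)) (mem_set (dA _ ABy))); rewrite /d.
case: ifPn => Ax; case: ifPn => Ay //; first by case.
case: ABx Ax => [/mem_set->//|Bx _].
case: ABy Ay => [/mem_set->//|By _] [hxy _].
by apply: (inj (f := h)) hxy; exact: mem_set.
Qed.

(** The countable case, from which the maximality argument of [card_seq_le]
starts. *)
Lemma nat_seq_code (T : pointedType) : infinite_set [set: T] ->
  exists A (f : seq T -> T), seq_code A f.
Proof.
move=> /infiniteP/pcard_leP[i]; exists (range i).
pose j := 'pinv_(fun=> 0) setT i.
exists (fun s => i (choice.pickle (map j s))).
split; first by move=> s _; exists (choice.pickle (map j s)).
move=> s t /set_mem sA /set_mem tA.
move/inj; rewrite !inE => /(_ I I)/(pcan_inj (@choice.pickleK _)).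
by apply: (inj_in_map (A := mem (range i))).
Qed.

(** By Zorn's lemma, there is a maximal set A with a code f for its finite
sequences.  Its complement cannot be as large as A: it would contain a copy B of
A, a sequence over the union of A and B could be turned into a sequence over A
by [double_code], and f followed by the bijection from A to B would code the new
sequences by elements of B.  So the complement injects into A, hence so does the
whole type by [double_code], and f codes all sequences. *)
Lemma card_seq_le (T : pointedType) : infinite_set [set: T] ->
  [set: seq T] #<= [set: T].
Proof.
move=> Toinf; pose code := {p : set T * (seq T -> T) | seq_code p.1 p.2}.
pose ext (p q : code) := (sval p).1 `<=` (sval q).1 /\
  {in seqs (sval p).1, (sval p).2 =1 (sval q).2}.
have [A0 [f0 f0P]] := nat_seq_code Toinf.
have ext_refl p : ext p p by split.
have ext_trans p q r : ext p q -> ext q r -> ext p r.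
  move=> [pq fpq] [qr fqr]; split=> [x /pq/qr//|s /[dup] sp /fpq ->].
  by apply/fqr/mem_set/(sub_seqs pq)/set_mem.
have chainP (C : set code) : total_on C (fun p q => `[< ext p q >]) ->
    exists q, forall p, C p -> `[< ext p q >].
  move=> Ctot; have [[p0 Cp0]|C0] := pselect (C !=set0); last first.
    by exists (exist _ (A0, f0) f0P) => p Cp; case: C0; exists p.
  pose A := \bigcup_(p in C) (sval p).1.
  (* By totality of the chain, one member of it accommodates both sequences. *)
  have Aseqs s t : seqs A s -> seqs A t ->
      exists p, [/\ C p, seqs (sval p).1 s & seqs (sval p).1 t].
    elim: s t => [|x s IHs].
      elim => [|y t IHt] _; first by exists p0.
      move=> /andP[/set_mem[q Cq qy] /(IHt isT)[p [Cp _ pt]]].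
      have [/asboolP[pq _]|/asboolP[qp _]] := Ctot _ _ Cp Cq.
        exists q; split=> //; rewrite /seqs /= mem_set //=.
        exact: sub_seqs pt.
      by exists p; split=> //; rewrite /seqs /= mem_set //=; exact: qp.
    move=> t /andP[/set_mem[q Cq qx] sA] /(IHs _ sA)[p [Cp ps pt]].
    have [/asboolP[pq _]|/asboolP[qp _]] := Ctot _ _ Cp Cq.
      exists q; split=> //; last exact: sub_seqs pt.
      by rewrite /seqs /= mem_set //=; exact: sub_seqs ps.
    by exists p; split=> //; rewrite /seqs /= mem_set //=; exact: qp.
  pose f s := get [set y |
    exists p, [/\ C p, seqs (sval p).1 s & y = (sval p).2 s]].
  have fE p s : C p -> seqs (sval p).1 s -> f s = (sval p).2 s.
    move=> Cp ps; apply: get_unique; first by exists p.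
    move=> _ [q [Cq qs ->]].
    by have [/asboolP[_ ->]|/asboolP[_ ->]] := Ctot _ _ Cp Cq; rewrite ?inE.
  have fP : seq_code A f.
    split=> [s As|s t /set_mem As /set_mem At].
      have [p [Cp ps _]] := Aseqs s s As As.
      by rewrite (fE p) //; exists p => //; have [+ _] := svalP p; exact.
    have [p [Cp ps pt]] := Aseqs _ _ As At; rewrite !(fE p) //.
    by have [_] := svalP p; apply; exact: mem_set.
  exists (exist _ (A, f) fP) => p Cp; apply/asboolP.
  by split=> [x px|s /set_mem/(fE _ _ Cp)]; first by exists p.
have [||[[A f] fP] fmax] := ZL_preorder (exist _ (A0, f0) f0P) _ _ chainP.
- by move=> p; apply/asboolP.
- by move=> p q r /asboolP pq /asboolP/(ext_trans _ _ _ pq)/asboolP.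
have fcode : seq_code A f := fP.
have [AC|CA] := card_le_total A (~` A); last first.
  have [c [cA c_inj]] := double_code fcode CA.
  have [_ f_inj] := fcode.
  apply/pcard_injP; exists (f \o map c) => s t _ _ /= /f_inj.
  rewrite setUv in cA c_inj.
  have cs u : seqs A (map c u).
    apply: (map_seqs cA); rewrite /seqs /=.
    by elim: u => //= x u ->; rewrite mem_set.
  move=> /(_ (mem_set (cs s)) (mem_set (cs t))).
  by apply: inj_map => x y; apply: c_inj; exact: mem_set.
have /pcard_leP[h] := AC.
have hA x : A x -> ~ A (h x) by move=> Ax; exact: (@funS _ _ _ _ h).
pose B := h @` A.
have BA : B #<= A := card_image_le _ _.
have [c [cA c_inj]] := double_code fcode BA.
(* Old sequences keep their codes, which are in A; new ones get codes in B. *)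
pose g s := if all (mem A) s then f s else h (f (map c s)).
have [fA f_inj] := fcode.
have gP : seq_code (A `|` B) g.
  have cs s : seqs (A `|` B) s -> A (f (map c s)).
    by move=> sAB; apply/fA/(map_seqs cA).
  split=> [s sAB|s t /set_mem sAB /set_mem tAB]; rewrite /g.
    case: ifPn => [/fA|_]; first by left.
    by right; exists (f (map c s)) => //; exact: cs.
  have fh u v : seqs A u -> seqs (A `|` B) v -> f u <> h (f (map c v)).
    by move=> /fA Afu /cs/hA Av fuv; rewrite -fuv in Av.
  case: ifPn => sA; case: ifPn => tA.
  - by apply: f_inj; rewrite inE.
  - by move/fh => /(_ sA tAB).
  - by move/esym/fh => /(_ tA sAB).
  move/inj; rewrite !inE => /(_ (cs _ sAB) (cs _ tAB)).
  move/f_inj; rewrite !inE => /(_ (map_seqs cA sAB) (map_seqs cA tAB)).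
  by apply: (inj_in_map (A := mem (A `|` B))).
have /asboolP[/= sub _] :
    `[< ext (exist _ (A `|` B, g) gP) (exist _ (A, f) fP) >].
  apply: fmax; apply/asboolP; split=> /=; first exact: subsetUl.
  by move=> s /set_mem sA; rewrite /g sA.
have Afn : A (f [::]) by exact: fA.
by case: (hA _ Afn); apply: sub; right; exists (f [::]).
Qed.

Lemma uncountable_cantor : ~ countable [set: cantor_space].
Proof.
move=> /pcard_surjP[e /(_ (fun n => ~~ e n n) I)[n _ /(congr1 (@^~ n))]].
by case: (e n n).
Qed.

Definition small T (A : set T) := card_lt A [set: cantor_space].

Lemma countable_small T (A : set T) : countable A -> small A.
Proof.
move=> Ac; split; last first.
  by apply/negP => /eq_countable/esym; rewrite Ac => /uncountable_cantor.
apply: card_le_trans Ac _; apply/pcard_injP.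
exists (fun n k => n == k) => n m _ _.
by move=> /(congr1 (@^~ m)); rewrite eqxx => /eqP.
Qed.

Lemma small_le T U (A : set T) (B : set U) : A #<= B -> small B -> small A.
Proof.
move=> AB [Bc BNc]; split; first exact: card_le_trans AB Bc.
apply: contra BNc => Ac; rewrite card_eq_le Bc /=.
by apply: card_le_trans AB; rewrite card_eq_le in Ac; case/andP: Ac.
Qed.

Lemma small_seq T : small [set: T] -> small [set: seq T].
Proof.
move=> Ts; have [Tfin|Tinf] := pselect (finite_set [set: T]).
  have [T' TT'] := Pcountable (finite_set_countable Tfin).
  by apply: countable_small; rewrite TT'; exact: countableP.
elim/Ppointed: T => T in Ts Tinf *.
  by case: Tinf; rewrite emptyE.
exact: small_le (card_seq_le Tinf) Ts.
Qed.

(** The union is an image of the finite sequences over A: a sequence of length 1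
gives its element, and the other lengths enumerate y. *)
Lemma small_setU_range T (A : set T) (y : nat -> T) :
  small A -> small (A `|` range y).
Proof.
move=> As; have [[x Ax]|A0] := pselect (A !=set0); last first.
  apply: countable_small; rewrite (_ : A = set0) ?set0U.
    exact: card_le_trans (card_image_le _ _) _.
  by apply/seteqP; split=> // x Ax; case: A0; exists x.
have /small_seq : small [set: A].
  by apply: small_le As; rewrite (card_le_eql (card_setT A)).
apply: small_le.
pose g (s : seq A) := if s is [:: a] then val a else y (size s).-2.
apply: card_le_trans (card_image_le g _); apply: subset_card_le => z.
move=> [Az|[n _ <-]]; first by exists [:: SigSub (mem_set Az)].
by exists (nseq n.+2 (SigSub (mem_set Ax))); rewrite // /g /= size_nseq.
Qed.

(** * A well-order of the continuum with small initial segments *)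

Record strict_well_order T (R : T -> T -> Prop) : Prop := StrictWellOrder {
  swo_wf : well_founded R;
  swo_trans : forall x y z, R x y -> R y z -> R x z;
  swo_total : forall x y, x <> y -> R x y \/ R y x }.

Lemma ex_strict_well_order (T : eqType) :
  exists R : T -> T -> Prop, strict_well_order R.
Proof.
have [R wo] := wochoice.well_ordering_principle T.
have tot x y : R x y \/ R y x.
  have [|z [[] +]] := wo (pred2 x y); first by exists x; rewrite inE eqxx.
  rewrite inE => /orP[]/eqP-> lb _; [left|right]; apply: lb;
  by rewrite inE eqxx ?orbT.
have refl x : R x x by case: (tot x x).
have anti x y : R x y -> R y x -> x = y.
  move=> xy yx; have [|z [_ uz]] := wo (pred2 x y).
    by exists x; rewrite inE eqxx.
  have minP t : t \in pred2 x y -> z = t.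
    move=> txy; apply: uz; split=> // u; rewrite inE.
    by move: txy; rewrite inE => /orP[]/eqP-> /orP[]/eqP->.
  by rewrite -(minP x) ?(minP y) // inE eqxx ?orbT.
have trans x y z : R x y -> R y z -> R x z.
  move=> xy yz; have [|m [[]]] := wo (pred3 x y z).
    by exists x; rewrite inE eqxx.
  rewrite inE => + lb _.
  have mx : R m x by apply: lb; rewrite inE eqxx.
  have my : R m y by apply: lb; rewrite inE eqxx orbT.
  have mz : R m z by apply: lb; rewrite inE eqxx !orbT.
  case/or3P => /eqP e; subst m; [by []|by rewrite (anti x y)|].
  by rewrite (anti z y).
exists (fun x y => R x y /\ x <> y); split.
- move=> x; apply: contrapT => nx.
  pose P := [pred x | ~~ `[< Acc (fun x y => R x y /\ x <> y) x >]].
  have [|z [[]]] := wo P; first by exists x; apply/asboolPn.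
  rewrite inE => /asboolPn nz lb _; apply: nz; constructor=> y [yz yNz].
  apply: contrapT => ny; apply: yNz; apply: anti => //; apply: lb.
  exact/asboolPn.
- move=> x y z [xy xNy] [yz yNz]; split; first exact: trans yz.
  by move=> xz; subst z; apply: xNy; exact: anti.
- by move=> x y xy; have [] := tot x y => ?; [left|right]; split=> // /esym.
Qed.

Lemma strict_well_order_inj T U (R : U -> U -> Prop) (g : T -> U) :
    injective g -> strict_well_order R ->
  strict_well_order (fun x y => R (g x) (g y)).
Proof.
move=> g_inj [wf trans tot]; split=> [x|x y z|x y xy].
- have [u ug] : exists u, u = g x by exists (g x).
  elim: (wf u) x ug => {}u _ IHu x ug; constructor=> y yx.
  by apply: (IHu (g y)) => //; rewrite ug.
- exact: trans.
- by apply: tot => /g_inj.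
Qed.

(** Take any well-order of the continuum.  If some initial segment is not small,
the least such segment is in bijection with the continuum, and its own proper
initial segments are small; so its order can be transported. *)
Lemma small_segments : exists2 R : cantor_space -> cantor_space -> Prop,
  strict_well_order R & forall x, small [set y | R y x].
Proof.
have [R swoR] := ex_strict_well_order cantor_space.
have [|/existsNP[x0]] := pselect (forall x, small [set y | R y x]).
  by exists R.
elim: (swo_wf swoR x0) => {}x0 _ IH Nsmall.
(* By induction, x0 may be assumed least with a segment that is not small. *)
have [sm|] := pselect (forall y, R y x0 -> small [set z | R z y]); last first.
  by move=> /existsNP[y /not_implyP[yx0 /IH]]; exact.
have /ppcard_leP[g] : [set: cantor_space] #<= [set y | R y x0].
  apply: contrapT => /negP le; apply: Nsmall; split; first exact: card_leT.
  by rewrite card_eq_le negb_and le orbT.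
have g_inj : injective g by move=> x y; apply: inj; rewrite inE.
exists (fun x y => R (g x) (g y)); first exact: strict_well_order_inj.
move=> x; apply: small_le (sm (g x) (@funS _ _ _ _ g x I)).
apply: (@card_ge_preimage _ _ [set z | R z (g x)] g) => y z _ _.
exact: g_inj.
Qed.

(** * Extending finite partial isometries *)

Definition dense_points (D : set binseq) :=
  forall n x, exists2 y, D y & agree n x y.

(** G is the graph of a partial map, which is automatically single-valued and
injective: points that agree to every order are equal. *)
Definition fixing_isometry (w : set nat) (G : set (binseq * binseq)) :=
  forall p, G p ->
    (forall q, G q -> forall n, agree n p.1 q.1 <-> agree n p.2 q.2) /\
    (forall k, w k -> p.1 k = p.2 k).

Lemma fixing_isometry_swap w G :
  fixing_isometry w G -> fixing_isometry w [set p | G (p.2, p.1)].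
Proof.
move=> iso p /iso[isoG fixw]; split=> [q /isoG /= pq n|k /fixw //].
by split=> /pq.
Qed.

Lemma fixing_isometry1 w G p : fixing_isometry w G ->
  (forall q, G q -> forall n, agree n p.1 q.1 <-> agree n p.2 q.2) ->
  (forall k, w k -> p.1 k = p.2 k) -> fixing_isometry w (p |` G).
Proof.
move=> iso pG pw r [->|/[dup] Gr /iso[isor rw]]; split=> // q [->|Gq] //.
- exact: pG.
- by move=> n; split=> /agree_sym/(pG _ Gr)/agree_sym.
- exact: isor.
Qed.

Lemma ex_closest (s : seq (binseq * binseq)) (x : binseq) : s != [::] ->
  exists2 p, p \in s &
    forall q, q \in s -> forall n, agree n x q.1 -> agree n x p.1.
Proof.
elim: s => // p [|q s] IHs _.
  by exists p; rewrite ?inE // => q /[!inE]/eqP->.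
have [c cs cP] := IHs isT; set t := q :: s in cs cP *.
have [xpc|/existsNP[n /not_implyP[xp xc]]] :=
  pselect (forall n, agree n x p.1 -> agree n x c.1).
  exists c; first by rewrite inE cs orbT.
  by move=> u; rewrite in_cons => /predU1P[->//|/cP].
exists p; first exact: mem_head.
move=> u; rewrite in_cons => /predU1P[->//|/cP xuc] m /xuc xcm.
case: (leqP m n) => [mn|/ltnW nm]; first exact: agree_le xp.
by case: xc; apply: agree_le xcm.
Qed.

(** The image t of x differs from x exactly where the closest point p.1 of the
domain differs from its image p.2; in particular not at digits in w.  The
distance from t to p.2 is then that from x to p.1, and the distances to the
other points follow, since the metric is ultrametric and each digit has only
two values. *)
Lemma isometry_extend_point w (s : seq (binseq * binseq)) x :
    fixing_isometry w [set` s] ->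
  exists2 t, (forall q, q \in s -> forall n, agree n x q.1 <-> agree n t q.2) &
             forall k, w k -> x k = t k.
Proof.
move=> iso; have [->|/(ex_closest x)[p ps pP]] := eqVneq s [::].
  by exists x.
have [isop pw] := iso _ ps.
pose t k := (x k (+) p.1 k) (+) p.2 k.
have tp n : agree n x p.1 -> agree n t p.2.
  by move=> xp k kn; rewrite /t xp // addbb.
have tpN n : t n = p.2 n -> x n = p.1 n.
  by rewrite /t; case: (x n); case: (p.1 n); case: (p.2 n).
exists t => [q qs n|k kw]; last first.
  by rewrite /t pw // -addbA addbb addbF.
split=> [xq|].
  apply: (agree_trans (tp _ (pP _ qs _ xq))); apply/(isop _ qs).
  exact: agree_trans (agree_sym (pP _ qs _ xq)) xq.
elim: n => // n IHn tq.
have xq : agree n x q.1 by apply: IHn => k /ltnW; exact: tq.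
have agreeS y z : agree n y z -> y n = z n -> agree n.+1 y z.
  by move=> yz yzn k; rewrite ltnS leq_eqVlt => /predU1P[->|/yz].
apply: (agreeS _ _ xq).
have pq : agree n p.1 q.1 := agree_trans (agree_sym (pP _ qs _ xq)) xq.
have [|pqn] := eqVneq (p.1 n) (q.1 n); last first.
  case: (eqVneq (x n) (p.1 n)) => [xpn|]; last first.
    by case: (x n) (p.1 n) (q.1 n) pqn => [] [] [].
  have xpS : agree n.+1 x p.1 by apply: agreeS => //; exact: pP xq.
  have pqS := agree_trans (agree_sym (tp _ xpS)) tq.
  by have /eqP := (isop _ qs n.+1).2 pqS n (ltnSn n); rewrite (negbTE pqn).
move=> pqn; rewrite -pqn; apply: tpN; rewrite tq //.
by apply/esym; apply: (isop _ qs n.+1).1 => //; exact: agreeS.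
Qed.

(** The ideal image t of x need not be in E, but distances from it to the
finitely many points of the range are positive unless x is already in the
domain; so a point of E close enough to t has the same distances. *)
Lemma isometry_extend (a : seq nat) (s : seq (binseq * binseq)) x E :
    fixing_isometry [set` a] [set` s] -> dense_points E ->
    (forall p, p \in s -> E p.2) ->
  exists2 y, E y & fixing_isometry [set` a] ((x, y) |` [set` s]).
Proof.
move=> iso Edense sE.
suff [y Ey [yP ya]] : exists2 y, E y &
    (forall q, q \in s -> forall n, agree n x q.1 <-> agree n y q.2) /\
    (forall k, k \in a -> x k = y k).
  by exists y => //; exact: fixing_isometry1.
have [[p ps <-]|xNs] := pselect (exists2 p, p \in s & p.1 = x).
  by have [] := iso _ ps; exists p.2 => //; exact: sE.
have [t tP ta] := isometry_extend_point x iso.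
have [N sN] : exists N, forall q, q \in s -> ~ agree N x q.1.
  elim: s xNs {iso sE tP} => [|p s IHs] xNs; first by exists 0.
  have [N sN] : exists N, forall q, q \in s -> ~ agree N x q.1.
    by apply: IHs => -[q qs qx]; apply: xNs; exists q; rewrite // inE qs orbT.
  have [M pM] : exists M, ~ agree M x p.1.
    apply/existsNP => xp; apply: xNs; exists p; first exact: mem_head.
    by apply/esym/agree_eq.
  exists (maxn N M) => q /[!inE]/predU1P[->|/sN qN] xq.
    by apply: pM; apply: agree_le xq; exact: leq_maxr.
  by apply: qN; apply: agree_le xq; exact: leq_maxl.
have [y Ey ty] := Edense (maxn N (\max_(k <- a) k).+1) t.
exists y => //; split=> [q qs n|k ka]; last first.
  rewrite ta // ty // leq_max ltnS orbC.
  by rewrite (big_rem k ka) /= leq_maxl.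
have tyN : agree N t y by apply: agree_le ty; exact: leq_maxl.
rewrite tP //; have [nN|/ltnW Nn] := leqP n N.
  have /agree_sym tyn := agree_le nN tyN.
  by split; apply: agree_trans => //; exact: agree_sym.
split=> [/(agree_le Nn)/(tP _ qs)/(sN _ qs)//|/(agree_le Nn) yq].
by case: (sN _ qs); apply/tP => //; exact: agree_trans yq.
Qed.

(** * The countable poset of approximations *)

Definition points (d e : nat -> binseq) (s : seq (nat * nat)) :=
  [seq (d ij.1, e ij.2) | ij <- s].

(** The first component approximates the set of preserved digits, the second the
graph.  Elements of D and E are represented by indices in fixed enumerations d
and e, so that the conditions form a countable type. *)
Definition is_cond d e (p : seq nat * seq (nat * nat)) :=
  `[< fixing_isometry [set` p.1] [set` points d e p.2] >].

Definition cond d e := {p | is_cond d e p}.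

HB.instance Definition _ d e := Countable.on (cond d e).

Fact cond_display : Order.disp_t.
Proof. exact: Order.Disp tt tt. Qed.

Section ConditionOrder.
Variables d e : nat -> binseq.

(** Stronger conditions are obtained by adding elements in front of the lists;
the suffix order records this and, unlike inclusion of the sets of elements, is
antisymmetric. *)
Definition cond_le (q p : cond d e) :=
  suffix (val p).1 (val q).1 && suffix (val p).2 (val q).2.

Lemma cond_le_refl : reflexive cond_le.
Proof. by move=> p; rewrite /cond_le !suffix_refl. Qed.

Lemma suffix_anti (T : eqType) (s t : seq T) :
  suffix s t -> suffix t s -> s = t.
Proof.
move=> /suffixP[u ->] /size_suffix; rewrite size_cat.
by case: u => //= x u; rewrite addSn ltnNge leq_addl.
Qed.

Lemma cond_le_anti : antisymmetric cond_le.
Proof.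
move=> p q /andP[/andP[qp1 qp2] /andP[pq1 pq2]]; apply: val_inj.
case: (val p) (val q) qp1 qp2 pq1 pq2 => [a s] [b t] /= *.
by congr pair; exact: suffix_anti.
Qed.

Lemma cond_le_trans : transitive cond_le.
Proof.
move=> q p r /andP[qp1 qp2] /andP[rq1 rq2].
by rewrite /cond_le (suffix_trans rq1 qp1) (suffix_trans rq2 qp2).
Qed.

HB.instance Definition _ :=
  Order.Le_isPOrder.Build cond_display (cond d e)
    cond_le_refl cond_le_anti cond_le_trans.

End ConditionOrder.

Section Generic.
Variables d e : nat -> binseq.
Hypothesis d_dense : dense_points (range d).
Hypothesis e_dense : dense_points (range e).

Definition meet_conds (S : set nat) : set (cond d e) :=
  [set p | exists2 k, S k & k \in (val p).1].
Definition dom_conds i : set (cond d e) :=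
  [set p | exists j, (i, j) \in (val p).2].
Definition ran_conds j : set (cond d e) :=
  [set p | exists i, (i, j) \in (val p).2].

Lemma ex_cond_pair (p : cond d e) i j :
    fixing_isometry [set` (val p).1]
      ((d i, e j) |` [set` points d e (val p).2]) ->
  exists2 q : cond d e, (i, j) \in (val q).2 & (q <= p)%O.
Proof.
case: p => -[a s] /= pc iso.
have qc : is_cond d e (a, (i, j) :: s).
  apply/asboolP; move: iso; congr (fixing_isometry _ _).
  by apply/seteqP; split=> r /=; rewrite inE => /predU1P.
exists (exist _ (a, (i, j) :: s) qc); first exact: mem_head.
by rewrite /Order.le /= /cond_le /= suffix_refl suffix_cons.
Qed.

Lemma dom_conds_dense i : poset_dense (dom_conds i).
Proof.
move=> p; have pe r : r \in points d e (val p).2 -> range e r.2.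
  by move=> /mapP[ij _ ->]; exists ij.2.
have [_ [j _ <-] /ex_cond_pair[q qij qp]] :=
  isometry_extend (d i) (asboolW (valP p)) e_dense pe.
by exists q => //; exists j.
Qed.

Lemma ran_conds_dense j : poset_dense (ran_conds j).
Proof.
move=> p; pose s := [seq (r.2, r.1) | r <- points d e (val p).2].
have sE : [set r | [set` points d e (val p).2] (r.2, r.1)] = [set` s].
  apply/seteqP; split=> [[x y] xy|_ /mapP[[x y] xy ->] //].
  by apply/mapP; exists (y, x).
have := fixing_isometry_swap (asboolW (valP p)); rewrite sE => iso.
have sd r : r \in s -> range d r.2.
  by move=> /mapP[_ /mapP[ij _ ->] ->]; exists ij.1.
have [_ [i _ <-] iso'] := isometry_extend (e j) iso d_dense sd.
have [|q qij qp] := @ex_cond_pair p i j; last by exists q => //; exists i.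
move: (fixing_isometry_swap iso'); congr (fixing_isometry _ _).
by rewrite -sE; apply/seteqP; split=> -[x y] /= [[-> ->]|?]; by [left|right].
Qed.

(** A digit k that belongs to S and to all the points d i and e j paired by p
can be added to p: each of those pairs has the digit 1 at k on both sides. *)
Lemma meet_conds_dense (F : set_system nat) S : ProperFilter F ->
    (forall i, F (d i)) -> (forall j, F (e j)) -> F S ->
  poset_dense (meet_conds S).
Proof.
move=> FF Fd Fe FS [[a s] pc]; have /asboolP/= iso := pc.
have [k [Sk sk]] :
    exists k, S k /\ (forall ij, ij \in s -> d ij.1 k && e ij.2 k).
  apply: (@filter_ex _ F); apply: filterI => //.
  elim: s {pc iso} => [|ij s IHs]; first exact: filterE.
  apply: filterS (filterI (filterI (Fd ij.1) (Fe ij.2)) IHs) => k [[dk ek] sk].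
  by move=> u; rewrite inE => /predU1P[->|/sk//]; rewrite dk ek.
have qc : is_cond d e (k :: a, s).
  apply/asboolP => p ps; have [isop pa] := iso p ps; split=> // m /=.
  rewrite inE => /predU1P[->|/pa//].
  by case/mapP: ps => ij /sk/andP[/= dk ek] ->; rewrite /= dk ek.
exists (exist _ (k :: a, s) qc); first by exists k => //; exact: mem_head.
by rewrite /Order.le /= /cond_le /= suffix_refl suffix_cons.
Qed.

Lemma suffix_mem (T : eqType) (s t : seq T) x :
  suffix s t -> x \in s -> x \in t.
Proof. by move=> /suffixP[u ->] xs; rewrite mem_cat xs orbT. Qed.

(** Any two elements of the digit set or of the graph already belong to a single
condition of K, because K is directed. *)
Lemma generic_isometry (K : set (cond d e)) : poset_filter K ->
    (forall i, K `&` dom_conds i !=set0) ->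
    (forall j, K `&` ran_conds j !=set0) ->
  exists w G, [/\ fixing_isometry w G, fst @` G = range d, snd @` G = range e &
    forall S, K `&` meet_conds S !=set0 -> w `&` S !=set0].
Proof.
move=> [_ _ Kdir] Kdom Kran.
exists [set k | exists2 p, K p & k \in (val p).1].
exists [set (d ij.1, e ij.2) |
    ij in [set ij | exists2 p, K p & ij \in (val p).2]].
split.
- have grow (p q : cond d e) ij : (q <= p)%O -> ij \in (val p).2 ->
      (d ij.1, e ij.2) \in points d e (val q).2.
    by move=> /andP[_ pq] /(suffix_mem pq) ijq; apply/mapP; exists ij.
  move=> _ [ij [p Kp ijp] <-]; split=> [_ [ij' [q Kq ijq] <-]|k [q Kq kq]].
    have [r [Kr rp rq]] := Kdir _ _ Kp Kq; have /asboolP iso := valP r.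
    by have [+ _] := iso _ (grow _ _ _ rp ijp); apply; exact: grow ijq.
  have [r [Kr rp /andP[rq _]]] := Kdir _ _ Kp Kq; have /asboolP iso := valP r.
  by have [_] := iso _ (grow _ _ _ rp ijp); apply; exact: suffix_mem kq.
- apply/seteqP; split=> [_ [_ [ij _ <-] <-]|_ [i _ <-]]; first by exists ij.1.
  have [p [Kp [j ijp]]] := Kdom i.
  by exists (d i, e j) => //; exists (i, j) => //; exists p.
- apply/seteqP; split=> [_ [_ [ij _ <-] <-]|_ [j _ <-]]; first by exists ij.2.
  have [p [Kp [i ijp]]] := Kran j.
  by exists (d i, e j) => //; exists (i, j) => //; exists p.
- by move=> S [p [Kp [k Sk kp]]]; exists k; split=> //; exists p.
Qed.

End Generic.

Lemma small_finI_from (A : set (set nat)) : small A -> small (finI_from A id).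
Proof.
move=> As; have /small_seq : small [set: A].
  by apply: small_le As; rewrite (card_le_eql (card_setT A)).
apply: small_le; pose cap (s : seq A) := \bigcap_(B in [set` s]) val B.
apply: card_le_trans (card_image_le cap _); apply: subset_card_le.
move=> _ [D DA <-]; exists (pmap insub (finmap.enum_fset D)) => //.
apply/seteqP; split=> k kD B /=.
  move=> BD; have BA := DA _ BD.
  by apply: (kD (SigSub BA)); rewrite /= mem_pmap_sub.
by rewrite mem_pmap_sub => /kD.
Qed.

Lemma ex_generic_isometry (d e : nat -> binseq) (A : set (set nat)) :
    MA_countable -> small A ->
    dense_points (range d) -> dense_points (range e) ->
    let F := filter_from (finI_from A id) id in
    ProperFilter F -> (forall i, F (d i)) -> (forall j, F (e j)) ->
  exists w G, [/\ fixing_isometry w G, fst @` G = range d, snd @` G = range e &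
    forall S, finI_from A id S -> w `&` S !=set0].
Proof.
move=> MA As d_dense e_dense F FF Fd Fe.
pose DD := (@meet_conds d e @` finI_from A id `|` range (@dom_conds d e)) `|`
  range (@ran_conds d e).
have [||||K Kfil Kgen] := MA _ (cond d e) DD.
- have c0 : is_cond d e ([::], [::]) by apply/asboolP.
  by exists (exist _ ([::], [::]) c0).
- exact: countableP.
- move=> _ [[[S AS <-]|[i _ <-]]|[j _ <-]].
  + by apply: (@meet_conds_dense d e F) => //; exists S.
  + exact: dom_conds_dense.
  + exact: ran_conds_dense.
- do 2 apply: small_setU_range.
  exact: small_le (card_image_le _ _) (small_finI_from As).
have [i|j|w [G [isoG Gd Ge Gw]]] := generic_isometry Kfil.
- by apply: Kgen; left; right; exists i.
- by apply: Kgen; right; exists j.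
exists w, G; split=> // S AS; apply: Gw; apply: Kgen; left; left.
by exists S.
Qed.

(** * From a dense isometry to a homeomorphism *)

(** Digit n of the image of x is digit n of the image of any point of the domain
that agrees with x up to and including digit n. *)
Definition completion (G : set (binseq * binseq)) (x : binseq) : binseq :=
  fun n => `[< exists2 p, G p & agree n.+1 x p.1 /\ p.2 n >].

Section Completion.
Variables (w : set nat) (G : set (binseq * binseq)).
Hypotheses (isoG : fixing_isometry w G) (G_dense : dense_points (fst @` G)).

Lemma completion_agree n x p :
  G p -> agree n x p.1 -> agree n (completion G x) p.2.
Proof.
move=> Gp xp k kn; apply/idP/idP => [/asboolP[q Gq [xq qk]]|pk].
  have [isop _] := isoG Gp; rewrite ((isop q Gq k.+1).1 _ k) //.
  by apply: agree_trans xq; apply/agree_sym/(agree_le kn).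
by apply/asboolP; exists p => //; split=> //; exact: agree_le xp.
Qed.

Lemma completion_nonexpansive n x y :
  agree n x y -> agree n (completion G x) (completion G y).
Proof.
move=> xy; have [_ [p Gp <-] yp] := G_dense n y.
apply: (agree_trans (completion_agree Gp (agree_trans xy yp))).
exact/agree_sym/completion_agree.
Qed.

Lemma completionE p : G p -> completion G p.1 = p.2.
Proof. by move=> Gp; apply: agree_eq => n; exact: completion_agree. Qed.

Lemma completion_fix x k : w k -> completion G x k = x k.
Proof.
move=> wk; have [_ [p Gp <-] xp] := G_dense k.+1 x.
rewrite (completion_agree Gp xp) // xp //.
by have [_ /(_ k wk)] := isoG Gp.
Qed.

End Completion.

Lemma completionK w G : fixing_isometry w G -> dense_points (fst @` G) ->
  cancel (completion G) (completion [set p | G (p.2, p.1)]).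
Proof.
move=> isoG Gd x; apply: agree_eq => n; have [_ [p Gp <-] xp] := Gd n x.
apply: agree_trans (agree_sym xp).
apply: (completion_agree (fixing_isometry_swap isoG) (p := (p.2, p.1))) => /=.
  by case: p Gp {xp}.
exact: (completion_agree isoG Gp xp).
Qed.

Lemma filter_pointE (U : set_system nat) (x : cantor_space) :
  (char_fun @` U) x <-> U x.
Proof.
split=> [[A UA <-]|Ux]; last first.
  exists x => //; apply/funext => n; rewrite /char_fun.
  by apply/idP/idP => [/set_mem|/mem_set].
rewrite (_ : (char_fun A : set nat) = A) //.
by apply/seteqP; split=> n /=; rewrite inE.
Qed.

Section FilterSpace.
Variables (U : set_system nat) (w : set nat).
Hypotheses (UF : Filter U) (Uw : U w).

(** The image of x contains the intersection of x with w. *)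
Lemma completion_filter G (x : filter_space U) : fixing_isometry w G ->
  dense_points (fst @` G) -> (char_fun @` U) (completion G (val x)).
Proof.
move=> isoG Gd; apply/filter_pointE; have /set_mem/filter_pointE Ux := valP x.
apply: filterS (filterI Ux Uw) => k [xk wk].
by rewrite /= (completion_fix isoG Gd).
Qed.

Definition filter_map G (isoG : fixing_isometry w G)
    (Gd : dense_points (fst @` G)) (x : filter_space U) : filter_space U :=
  SigSub (mem_set (completion_filter x isoG Gd)).

Lemma filter_map_continuous G isoG Gd : continuous (@filter_map G isoG Gd).
Proof.
have cval : continuous (val : filter_space U -> cantor_space).
  exact: initial_continuous.
have cG : continuous (completion G : cantor_space -> cantor_space).
  by apply: nonexpansive_continuous; exact: completion_nonexpansive isoG Gd.
apply: continuous_comp_initial.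
exact: (fun x => continuous_comp (cval x) (cG (val x))).
Qed.

Lemma filter_homeomorphism G (D E : set (filter_space U)) :
    fixing_isometry w G -> dense_points (fst @` G) -> dense_points (snd @` G) ->
    fst @` G = val @` D -> snd @` G = val @` E ->
  exists2 h : filter_space U -> filter_space U, homeomorphism h & h @` D = E.
Proof.
move=> isoG Gd Gr GD GE.
have isoH := fixing_isometry_swap isoG; set H := [set p | _] in isoH.
have Hd : dense_points (fst @` H).
  move=> n x; have [_ [p Gp <-] xp] := Gr n x; exists p.2 => //.
  by exists (p.2, p.1) => //; case: p Gp {xp}.
have HG : [set p | H (p.2, p.1)] = G by apply/seteqP; split=> -[].
have hK : cancel (filter_map isoG Gd) (filter_map isoH Hd).
  by move=> x; apply: val_inj; rewrite /= (completionK isoG Gd).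
exists (filter_map isoG Gd).
  split; first exact: filter_map_continuous.
  exists (filter_map isoH Hd); split=> //; last exact: filter_map_continuous.
  move=> x; apply: val_inj => /=.
  by have := completionK isoH Hd (val x); rewrite HG.
apply/seteqP; split=> [_ [x Dx <-]|y Ey].
  have [p Gp px] : (fst @` G) (val x) by rewrite GD; exists x.
  have [y Ey yp] : (val @` E) p.2 by rewrite -GE; exists p.
  rewrite (_ : filter_map _ _ _ = y) //; apply: val_inj.
  by rewrite /= yp -px (completionE isoG).
have [p Gp py] : (snd @` G) (val y) by rewrite GE; exists y.
have [x Dx xp] : (val @` D) p.1 by rewrite -GD; exists p.
by exists x => //; apply: val_inj; rewrite /= xp (completionE isoG).
Qed.

End FilterSpace.

(** Since U contains the cofinite sets, it is dense in the Cantor set. *)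
Lemma dense_filter_points (U : set_system nat) (D : set (filter_space U)) :
    Filter U -> (forall n, U [set k | n <= k]) -> dense D ->
  dense_points (val @` D).
Proof.
move=> UF Utail Ddense n x.
have Uy : (char_fun @` U) (fun k => if k < n then x k else true).
  apply/filter_pointE; apply: filterS (Utail n) => k /= nk.
  by rewrite ltnNge nk.
have [||y [xy Dy]] := Ddense [set y | agree n x (val y)].
- by exists (SigSub (mem_set Uy)) => k kn /=; rewrite kn.
- by exists (agree n x); first exact: open_agree.
- by exists (val y); first by exists y.
Qed.

(** * The construction of the ultrafilter *)

Lemma wf_recursion I T (R : I -> I -> Prop) (step : set T -> I -> T) :
  well_founded R -> exists w, forall x, w x = step (w @` [set y | R y x]) x.
Proof.
move=> wf.
pose F x (rec : forall y, R y x -> T) :=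
  step [set t | exists y yx, rec y yx = t] x.
exists (Fix wf (fun=> T) F) => x; rewrite Fix_eq; last first.
  move=> {}x f g fg; congr F.
  apply/functional_extensionality_dep => y.
  exact/functional_extensionality_dep.
congr step; apply/seteqP; split=> [_ [y [yx <-]]|_ [y yx <-]].
  by exists y.
by exists y, yx.
Qed.

Definition tails : set (set nat) := range (fun n => [set k | n <= k]).

Lemma finI_tails : finI tails id.
Proof. by apply: (@filter_finI _ \oo) => _ [n _ <-]; exists n. Qed.

Lemma finI_setU1 (A : set (set nat)) w :
  (forall S, finI_from A id S -> w `&` S !=set0) -> finI (w |` A) id.
Proof.
move=> wA D DA; pose D' := (D `\ w)%fset.
have [|k [wk Sk]] := wA (\bigcap_(B in [set` D']) B).
  exists D' => // B; rewrite in_fsetD1 => /andP[/eqP Bw /DA].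
  by rewrite !inE => -[].
exists k => B /= BD; have [->//|Bw] := eqVneq B w.
by apply: Sk; rewrite /= in_fsetD1 Bw.
Qed.

(** Once w is in U, either the enumerated pair is matched by an isometry
preserving the digits in w, or it is not a pair of subsets of U. *)
Definition resolves (d e : nat -> binseq) (w : set nat) :=
  [\/ exists G,
        [/\ fixing_isometry w G, fst @` G = range d & snd @` G = range e],
      exists i, w = ~` (d i) | exists j, w = ~` (e j)].

Lemma ex_resolving (A : set (set nat)) (d e : nat -> binseq) :
    MA_countable -> small A -> finI A id ->
    dense_points (range d) -> dense_points (range e) ->
  exists2 w, finI (w |` A) id & resolves d e w.
Proof.
move=> MA As finA d_dense e_dense; pose F := filter_from (finI_from A id) id.
have FF : ProperFilter F := finI_filter finA.
have add_compl B : ~ F B -> finI (~` B |` A) id.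
  move=> FB; apply: finI_setU1 => S AS; apply/set0P/eqP => SB.
  apply: FB; exists S => //.
  by rewrite -[B]setCK; apply/disjoints_subset; rewrite setIC.
have [Fd|/existsNP[i /add_compl]] := pselect (forall i, F (d i)); last first.
  by exists (~` d i) => //; apply: Or32; exists i.
have [Fe|/existsNP[j /add_compl]] := pselect (forall j, F (e j)); last first.
  by exists (~` e j) => //; apply: Or33; exists j.
have [w [G [isoG Gd Ge wA]]] :=
  ex_generic_isometry MA As d_dense e_dense FF Fd Fe.
exists w; first exact: finI_setU1.
by apply: Or31; exists G.
Qed.

(** Finitely many sets are all chosen by the last of the stages involved. *)
Lemma finI_chain I (R : I -> I -> Prop) (w : I -> set nat) (P : set I) :
    strict_well_order R ->
    (forall x, P x -> finI (w x |` (w @` [set y | R y x] `|` tails)) id) ->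
  finI (w @` P `|` tails) id.
Proof.
move=> [_ Rtrans Rtot]; pose A x := w x |` (w @` [set y | R y x] `|` tails).
move=> finA D DP.
have sub_chain x y : R x y -> A x `<=` A y.
  move=> xy B [->|[[z /= zx <-]|]]; right.
  - by left; exists x.
  - by left; exists z => //; exact: Rtrans xy.
  - by right.
have sA (s : seq (set nat)) : {subset s <= w @` P `|` tails} ->
    {subset s <= tails} \/ exists2 x, P x & {subset s <= A x}.
  elim: s => [|B s IHs] sP; first by left.
  have [|stail|[x Px sx]] := IHs.
    by move=> C Cs; apply: sP; rewrite inE Cs orbT.
    have := sP B (mem_head _ _); rewrite inE => -[[y Py yB]|Bt].
      right; exists y => // C; rewrite in_cons => /predU1P[->|/stail].
        by rewrite inE; left.
      by rewrite !inE; right; right.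
    by left=> C; rewrite in_cons => /predU1P[->|/stail //]; rewrite inE.
  right; have := sP B (mem_head _ _).
  rewrite inE => -[[y Py yB]|Bt]; last first.
    exists x => // C; rewrite in_cons => /predU1P[->|/sx //].
    by rewrite inE; right; right.
  have By : A y B by left.
  have [xy|xNy] := pselect (x = y).
    exists x => // C; rewrite in_cons => /predU1P[->|/sx //].
    by rewrite inE xy.
  have [xy|yx] := Rtot _ _ xNy.
    exists y => // C; rewrite in_cons => /predU1P[->|/sx]; rewrite !inE //.
    exact: sub_chain.
  exists x => // C; rewrite in_cons => /predU1P[->|/sx]; rewrite !inE //.
  exact: sub_chain By.
have [Dt|[x Px Dx]] := sA _ DP; first exact: finI_tails Dt.
exact: finA Px _ Dx.
Qed.

(** A single point codes two sequences of points, so that the points of the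
Cantor set can index the stages of the construction. *)
Definition decode (b : bool) (c : binseq) : nat -> binseq :=
  fun i k => c (choice.pickle (b, i, k)).

Lemma decode_surj d e : exists c, decode true c = d /\ decode false c = e.
Proof.
exists (fun n => if choice.unpickle n is Some (b, i, k)
  then (if b then d else e) i k else false).
by split; apply/funext => i; apply/funext => k; rewrite /decode choice.pickleK.
Qed.

(** At stage c, the pair coded by c is resolved by [ex_resolving] against the
sets chosen before, together with the cofinite intervals. *)
Lemma resolving_ultrafilter : MA_countable -> exists U : set_system nat,
  [/\ UltraFilter U, forall n, U [set k | n <= k] &
    forall d e, dense_points (range d) -> dense_points (range e) ->
      exists2 w, U w & resolves d e w].
Proof.
move=> MA; have [R swoR smallR] := small_segments.
pose good A c w := small A -> finI (A `|` tails) id ->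
  finI (w |` (A `|` tails)) id /\
  (dense_points (range (decode true c)) ->
   dense_points (range (decode false c)) ->
   resolves (decode true c) (decode false c) w).
have /choice[step stepP] (Ac : set (set nat) * cantor_space) :
    exists w, good Ac.1 Ac.2 w.
  case: Ac => A c; rewrite /good /=.
  have [[[As Afin] [cd ce]]|H] := pselect (
      (small A /\ finI (A `|` tails) id) /\
      (dense_points (range (decode true c)) /\
       dense_points (range (decode false c)))).
    have At : small (A `|` tails) by exact: small_setU_range.
    by have [w ? ?] := ex_resolving MA At Afin cd ce; exists w.
  (* A stage that codes no pair of dense sets adds nothing new. *)
  exists setT => As Afin; split=> [|cd ce]; last by case: H.
  by apply: finI_setU1 => S [D DA <-]; rewrite setTI; exact: Afin.
have [w wE] := wf_recursion (fun A c => step (A, c)) (swo_wf swoR).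
have seg_small x : small (w @` [set y | R y x]).
  exact: small_le (card_image_le _ _) (smallR x).
have seg_fin x : finI (w @` [set y | R y x] `|` tails) id.
  elim: (swo_wf swoR x) => {}x _ IHx; apply: finI_chain swoR _ => y yx.
  have := stepP (w @` [set z | R z y], y) (seg_small y) (IHx y yx).
  by rewrite /= -wE => -[].
have wP x := stepP (w @` [set z | R z x], x) (seg_small x) (seg_fin x).
rewrite /= in wP.
have finT : finI (range w `|` tails) id.
  by apply: finI_chain swoR _ => x _; have [+ _] := wP x; rewrite -wE.
have [U [UU FU]] := ultraFilterLemma (finI_filter finT).
have genU B : (range w `|` tails) B -> U B.
  by move=> AB; apply: FU; exists B => //; exact: (@finI_from1 _ _ _ id).
exists U; split=> // [n|d e d_dense e_dense].
  by apply: genU; right; exists n.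
have [c [dc ec]] := decode_surj d e.
exists (w c); first by apply: genU; left; exists c.
by have [_] := wP c; rewrite -wE dc ec; apply.
Qed.

Lemma dense_enum (U : set_system nat) (D : set (filter_space U)) : Filter U ->
    (forall n, U [set k | n <= k]) -> countable D -> dense D ->
  exists2 d : nat -> binseq, range d = val @` D & dense_points (range d).
Proof.
move=> UF Utail Dc Dd; have DD := dense_filter_points UF Utail Dd.
have /pfcard_geP[D0|[f]] := Dc.
  by have [y] := DD 0 (fun=> true); rewrite D0 image_set0.
have rangeE : range (fun i => val (f i)) = val @` D.
  rewrite -(image_comp f val); congr image; apply/seteqP; split.
    by move=> _ [i _ <-]; exact: funS.
  exact: surj.
by exists (fun i => val (f i)); rewrite ?rangeE.
Qed.

Theorem theorem21 :
  MA_countable ->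
  exists U : set_system nat,
    [/\ UltraFilter U, nonprincipal U &
        countable_dense_homogeneous (filter_space U)].
Proof.
move=> /resolving_ultrafilter[U [UU Utail Ures]]; exists U; split=> //.
  move=> n Un; have : U [set k | n.+1 <= k] by [].
  by rewrite Un => /principal_filterP; rewrite /= ltnn.
have UP : ProperFilter U := ultra_proper.
have UF : Filter U by exact: filter_filter.
move=> D E Dc Dd Ec Ed.
have [d dD d_dense] := dense_enum _ Utail Dc Dd.
have [e eE e_dense] := dense_enum _ Utail Ec Ed.
have memU x (C : set (filter_space U)) : (val @` C) x -> ~ U (~` x).
  move=> [y _ <-] UNy; have /set_mem/filter_pointE Uy := valP y.
  have [k [yk yNk]] : (val y `&` ~` val y : set nat) !=set0.
    by apply: (@filter_ex _ U); exact: filterI.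
  by [].
have [w Uw [[G [isoG Gd Ge]]|[i wi]|[j wj]]] := Ures d e d_dense e_dense.
- by apply: (filter_homeomorphism _ Uw isoG); rewrite ?Gd ?Ge.
- by case: (memU (d i) D); rewrite -?wi // -dD; exists i.
- by case: (memU (e j) E); rewrite -?wj // -eE; exists j.
Qed.
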